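(* Let $L>0$ be fixed and let $(b,\omega,k)\in(0,+\infty)\times(-1,1)\times(0,1/\sqrt2)$. If $a=c<0$, $b=d>0$ and $a+b=0$, then the system $$-\omega \varphi+\psi+\varphi \psi+a \psi''+b\omega \varphi''-A_1=0,\qquad -\omega \psi+\varphi+\tfrac{1}{2}\psi^2+c\varphi''+d\omega \psi''-A_2=0,$$ for some real constants $A_1,A_2$, has $L$-periodic solutions $(\varphi,\psi)=(\varphi,B\varphi)\in C^\infty_{per}([0,L])\times C^\infty_{per}([0,L])$ with $\varphi$ of the cnoidal form $$\varphi(x)=b_0+b_2\,\mathrm{cn}^2\left(\frac{2K(k)}{L}x,k\right).$$ The parameters $b_0,b_2,B$ depend smoothly on $b>0$, $\omega\in(-1,1)$ and $k\in(0,1/\sqrt2)$ and are given by $$B=-\frac{\omega}{2}+\frac12\sqrt{\omega^2+8}>0\quad\text{or}\quad B=-\frac{\omega}{2}-\frac12\sqrt{\omega^2+8}<0,$$ $$b_0=\frac{-64(B\omega-1)^2\,b\,(k^2-\frac12)K(k)^2+2\left((\omega^2+\frac12)B-\frac32\omega\right)BL^2}{2B^2L^2(B\omega-1)},\qquad b_2=\frac{48\,b\,k^2(B\omega-1)K(k)^2}{B^2L^2}.$$ In addition, $\varphi<0$.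
   Context: $K(k)$ is the complete elliptic integral of the first kind with modulus $k$, and $\mathrm{cn}(\cdot,k)$ is the Jacobi cnoidal function with modulus $k$. $C^\infty_{per}([0,L])$ is the space of real-valued smooth $L$-periodic functions. *)

(* Defs.v *)
From Stdlib Require Import Reals ClassicalEpsilon.
From Coquelicot Require Import Coquelicot.
Local Open Scope R_scope.

(* The second argument k of the elliptic functions is the modulus
   (not the parameter m = k^2). *)
Definition ellipticF (phi k : R) : R :=
  RInt (fun t => / sqrt (1 - k ^ 2 * sin t ^ 2)) 0 phi.

Definition ellipticK (k : R) : R := ellipticF (PI / 2) k.

(* For k^2 < 1 the map phi |-> ellipticF phi k is an increasing bijection of R,
   so the choice below is its inverse; for other k the value is irrelevant. *)
Definition jacobi_am (u k : R) : R :=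
  epsilon (inhabits 0) (fun phi => ellipticF phi k = u).

Definition jacobi_cn (u k : R) : R := cos (jacobi_am u k).

Definition smooth_periodic (L : R) (f : R -> R) : Prop :=
  (forall n x, ex_derive_n f n x) /\ (forall x, f (x + L) = f x).

(* C^n on D, for an open D: all partial derivatives of order at most n exist
   and are continuous on D; f1, f2, f3 are the first partial derivatives. *)
Fixpoint C_n_on (D : R * R * R -> Prop) (n : nat) (f : R * R * R -> R) : Prop :=
  (forall p, D p -> continuous f p) /\
  match n with
  | O => True
  | S m =>
      exists f1 f2 f3 : R * R * R -> R,
        (forall x y z, D (x, y, z) ->
           is_derive (fun t => f (t, y, z)) x (f1 (x, y, z)) /\
           is_derive (fun t => f (x, t, z)) y (f2 (x, y, z)) /\
           is_derive (fun t => f (x, y, t)) z (f3 (x, y, z))) /\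
        C_n_on D m f1 /\ C_n_on D m f2 /\ C_n_on D m f3
  end.

Definition smooth_on (D : R * R * R -> Prop) (f : R * R * R -> R) : Prop :=
  forall n, C_n_on D n f.

Definition param_domain (p : R * R * R) : Prop :=
  let '(b, omega, k) := p in 0 < b /\ -1 < omega < 1 /\ 0 < k < 1 / sqrt 2.

Definition B_plus (omega : R) : R := - (omega / 2) + 1 / 2 * sqrt (omega ^ 2 + 8).

Definition B_minus (omega : R) : R := - (omega / 2) - 1 / 2 * sqrt (omega ^ 2 + 8).

Definition coef_b0 (L B b omega k : R) : R :=
  (- 64 * (B * omega - 1) ^ 2 * b * (k ^ 2 - 1 / 2) * ellipticK k ^ 2
   + 2 * ((omega ^ 2 + 1 / 2) * B - 3 / 2 * omega) * B * L ^ 2)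
  / (2 * B ^ 2 * L ^ 2 * (B * omega - 1)).

Definition coef_b2 (L B b omega k : R) : R :=
  48 * b * k ^ 2 * (B * omega - 1) * ellipticK k ^ 2 / (B ^ 2 * L ^ 2).

(* Main.v *)
Require Import Defs.
From Stdlib Require Import Reals Lra ClassicalEpsilon.
From Coquelicot Require Import Coquelicot.
Local Open Scope R_scope.

(** The substitution [psi = B phi] turns the system, for [a = c = - b] and
    [d = b], into
      [(B - omega) (phi - b phi'') + B phi^2 = A1],
      [(1 - B omega) (phi - b phi'') + B^2 / 2 phi^2 = A2],
    and these two equations are proportional with ratio [2 / B] exactly
    when [B^2 + omega B - 2 = 0], whose roots are [B_plus] and [B_minus].
    What remains is one scalar equation.  The square of the cnoidal function
    satisfies
      [(cn^2)'' = 2 (1 - k^2) + 4 (2 k^2 - 1) cn^2 - 6 k^2 cn^4],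
    so for [phi = b0 + b2 cn^2] the scalar equation is polynomial in [cn^2].
    The coefficient of [cn^4] forces [b2], that of [cn^2] forces [b0], and the
    constant term only defines [A2].  Since [|B| > 1] we have
    [B omega - 1 = 1 - B^2 < 0], hence [b0 < 0] (here [k^2 < 1/2] is used) and
    [b2 <= 0], which gives [phi < 0].

    The analytic facts about [cn] come from the amplitude.  The integrand of
    [ellipticF] is at least 1, so [ellipticF] expands distances and is a
    bijection of [R]; its inverse is 1-Lipschitz and the mean value theorem
    differentiates it ([is_derive_am]).  The symmetries of the sine give
    [ellipticF (phi + PI) = ellipticF phi + 2 K], so [cn^2] has period [2 K].

    Both smoothness claims rest on the same device: a family of functions
    each of which has its first derivatives in the family consists of smooth
    functions.  In [x] the family is that of the polynomials in [f] and [f'],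
    where [f'' = al + be f + ga f^2].  In the parameters it is the algebra
    generated by the coordinates, [sqrt (omega^2 + 8)], reciprocals, and the
    integrals [J m n] of [sin^m / Delta^n] over a quarter period: these
    include [K], and differentiation in [k] stays in the algebra because
    [d/dk (J m n) = n k J (m + 2) (n + 2)]. *)

(** * The elliptic integral and the amplitude *)

Definition Delta (k t : R) : R := sqrt (1 - k ^ 2 * sin t ^ 2).

Lemma sin_sqr_bound t : 0 <= sin t ^ 2 <= 1.
Proof. pose proof (sin2_cos2 t) as H; unfold Rsqr in H; nra. Qed.

Lemma Delta_arg_pos k t : -1 < k < 1 -> 0 < 1 - k ^ 2 * sin t ^ 2.
Proof. intros hk; pose proof (sin_sqr_bound t); nra. Qed.

Lemma Delta_pos k t : -1 < k < 1 -> 0 < Delta k t.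
Proof. intros hk; apply sqrt_lt_R0, Delta_arg_pos, hk. Qed.

Lemma Delta_le_1 k t : Delta k t <= 1.
Proof.
  rewrite <- sqrt_1; apply sqrt_le_1_alt.
  pose proof (sin_sqr_bound t); nra.
Qed.

Lemma Delta_sqr k t : -1 < k < 1 -> Delta k t ^ 2 = 1 - k ^ 2 * sin t ^ 2.
Proof. intros hk; apply pow2_sqrt, Rlt_le, Delta_arg_pos, hk. Qed.

Lemma is_derive_Delta k t : -1 < k < 1 ->
  is_derive (Delta k) t (- k ^ 2 * sin t * cos t / Delta k t).
Proof.
  intros hk; pose proof (Delta_arg_pos k t hk); pose proof (Delta_pos k t hk).
  unfold Delta in *; auto_derive; [lra|].
  replace (1 + - (k * (k * 1) * (sin t * (sin t * 1))))
    with (1 - k ^ 2 * sin t ^ 2) by ring.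
  field; lra.
Qed.

Lemma continuous_Delta k t : -1 < k < 1 -> continuous (Delta k) t.
Proof.
  intros hk; apply (@ex_derive_continuous R_AbsRing R_NormedModule).
  eexists; apply (is_derive_Delta k t hk).
Qed.

Lemma is_derive_ellipticF k phi : -1 < k < 1 ->
  is_derive (fun t : R => ellipticF t k) phi (/ Delta k phi).
Proof.
  intros hk.
  assert (hc : forall z, continuous (fun t => / Delta k t) z).
  { intros z; apply continuous_Rinv_comp; [apply continuous_Delta, hk|].
    pose proof (Delta_pos k z hk); lra. }
  apply (is_derive_RInt (fun t => / Delta k t) _ 0); [|apply hc].
  apply filter_forall; intros y; apply (@RInt_correct R_CompleteNormedModule).
  apply (@ex_RInt_continuous R_CompleteNormedModule); intros; apply hc.
Qed.

Lemma continuity_pt_ellipticF k phi : -1 < k < 1 ->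
  continuity_pt (fun t => ellipticF t k) phi.
Proof.
  intros hk; apply continuity_pt_filterlim.
  apply (@ex_derive_continuous R_AbsRing R_NormedModule
    (fun t => ellipticF t k)).
  exists (/ Delta k phi); apply (is_derive_ellipticF k phi hk).
Qed.

Lemma derive_zero_constant (f : R -> R) :
  (forall x, is_derive f x 0) -> forall x y, f x = f y.
Proof.
  intros hf x y.
  destruct (MVT_gen f x y (fun _ => 0)) as [c [_ hc]].
  - intros; apply hf.
  - intros; apply continuity_pt_filterlim.
    apply (@ex_derive_continuous R_AbsRing R_NormedModule); eexists; apply hf.
  - lra.
Qed.

Lemma ellipticF_0 k : ellipticF 0 k = 0.
Proof. apply (@RInt_point R_CompleteNormedModule). Qed.

Lemma ellipticF_opp k phi : -1 < k < 1 ->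
  ellipticF (- phi) k = - ellipticF phi k.
Proof.
  intros hk.
  assert (h : forall x, is_derive
    (fun t => ellipticF t k + ellipticF (- t) k) x 0).
  { intros x.
    pose proof (is_derive_ellipticF k x hk) as h1.
    pose proof (is_derive_ellipticF k (- x) hk) as h2.
    auto_derive.
    - repeat split; eexists; [apply h1 | apply h2].
    - rewrite (is_derive_unique _ _ _ h1), (is_derive_unique _ _ _ h2).
      unfold Delta; rewrite sin_neg.
      replace ((- sin x) ^ 2) with (sin x ^ 2) by ring; ring. }
  pose proof (derive_zero_constant _ h phi 0) as e; simpl in e.
  rewrite Ropp_0, ellipticF_0 in e; lra.
Qed.

(** The difference of the two sides has derivative zero because [sin^2] has
    period [PI]; its value at [- PI / 2] is settled by oddness. *)
Lemma ellipticF_shift k phi : -1 < k < 1 ->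
  ellipticF (phi + PI) k = ellipticF phi k + 2 * ellipticK k.
Proof.
  intros hk.
  assert (h : forall x, is_derive
    (fun t => ellipticF (t + PI) k - ellipticF t k) x 0).
  { intros x.
    pose proof (is_derive_ellipticF k x hk) as h1.
    pose proof (is_derive_ellipticF k (x + PI) hk) as h2.
    auto_derive.
    - repeat split; eexists; [apply h2 | apply h1].
    - rewrite (is_derive_unique _ _ _ h1), (is_derive_unique _ _ _ h2).
      unfold Delta; rewrite neg_sin.
      replace ((- sin x) ^ 2) with (sin x ^ 2) by ring; ring. }
  pose proof (derive_zero_constant _ h phi (- (PI / 2))) as e; simpl in e.
  rewrite (ellipticF_opp k (PI / 2) hk) in e.
  replace (- (PI / 2) + PI) with (PI / 2) in e by field.
  unfold ellipticK; lra.
Qed.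

(** The mean value theorem for [ellipticF], solved for the increment of the
    argument; [Delta <= 1] makes it an expansion estimate. *)
Lemma ellipticF_mvt k x y : -1 < k < 1 ->
  exists c, Rmin x y <= c <= Rmax x y /\
    y - x = Delta k c * (ellipticF y k - ellipticF x k).
Proof.
  intros hk.
  destruct (MVT_gen (fun t => ellipticF t k) x y (fun t => / Delta k t))
    as [c [hc e]].
  - intros; apply is_derive_ellipticF, hk.
  - intros; apply continuity_pt_ellipticF, hk.
  - exists c; split; [exact hc|].
    rewrite e; field; pose proof (Delta_pos k c hk); lra.
Qed.

Lemma ellipticF_inj k x y : -1 < k < 1 ->
  ellipticF x k = ellipticF y k -> x = y.
Proof.
  intros hk e; destruct (ellipticF_mvt k x y hk) as [c [_ h]].
  rewrite e in h; nra.
Qed.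

Lemma ellipticF_surj k u : -1 < k < 1 -> exists phi, ellipticF phi k = u.
Proof.
  intros hk.
  destruct (IVT_gen (fun t => ellipticF t k) 0 u u) as [x [_ hx]].
  - intros t; apply continuity_pt_ellipticF, hk.
  - (* [ellipticF] lies above the identity on the right of 0 and below it on
       the left, so [u] lies between 0 and [ellipticF u]. *)
    rewrite ellipticF_0.
    destruct (ellipticF_mvt k 0 u hk) as [c [_ h]]; rewrite ellipticF_0 in h.
    pose proof (Delta_pos k c hk); pose proof (Delta_le_1 k c).
    unfold Rmin, Rmax; repeat destruct Rle_dec; nra.
  - exists x; exact hx.
Qed.

Lemma ellipticF_am k u : -1 < k < 1 -> ellipticF (jacobi_am u k) k = u.
Proof.
  intros hk; unfold jacobi_am.
  apply (epsilon_spec (inhabits 0) (fun phi => ellipticF phi k = u)).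
  apply ellipticF_surj, hk.
Qed.

Lemma am_shift k u : -1 < k < 1 ->
  jacobi_am (u + 2 * ellipticK k) k = jacobi_am u k + PI.
Proof.
  intros hk; apply (ellipticF_inj k _ _ hk).
  rewrite ellipticF_shift, !ellipticF_am by exact hk; reflexivity.
Qed.

(** By the mean value theorem a difference quotient of the amplitude is a
    value of [Delta] at a point [c] between the two amplitudes; these differ
    by at most [h], so continuity of [Delta] gives the limit. *)
Lemma is_derive_am k u : -1 < k < 1 ->
  is_derive (fun v : R => jacobi_am v k) u (Delta k (jacobi_am u k)).
Proof.
  intros hk; apply is_derive_Reals; intros eps heps.
  pose proof (continuous_Delta k (jacobi_am u k) hk) as hc.
  destruct (proj1 (filterlim_locally _ _) hc (mkposreal eps heps))
    as [delta hd].
  exists delta; intros h h0 hh.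
  destruct (ellipticF_mvt k (jacobi_am u k) (jacobi_am (u + h) k) hk)
    as [c [hcb e]].
  rewrite !ellipticF_am in e by exact hk.
  replace (u + h - u) with h in e by ring.
  rewrite e; replace (Delta k c * h / h) with (Delta k c) by (field; exact h0).
  apply (hd c); change (Rabs (c - jacobi_am u k) < delta).
  apply Rle_lt_trans with (2 := hh).
  apply Rle_trans with (Rabs (Delta k c * h)).
  - rewrite <- e; unfold Rmin, Rmax, Rabs in *.
    repeat destruct Rle_dec; repeat destruct Rcase_abs; lra.
  - rewrite Rabs_mult, (Rabs_pos_eq (Delta k c)).
    + pose proof (Delta_le_1 k c); pose proof (Rabs_pos h); nra.
    + apply Rlt_le, Delta_pos, hk.
Qed.

(** * The square of the cnoidal function *)

Definition cn2 (k u : R) : R := jacobi_cn u k ^ 2.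

Definition cn2' (k u : R) : R :=
  - 2 * cos (jacobi_am u k) * sin (jacobi_am u k) * Delta k (jacobi_am u k).

Lemma cn2_periodic k u : -1 < k < 1 -> cn2 k (u + 2 * ellipticK k) = cn2 k u.
Proof.
  intros hk; unfold cn2, jacobi_cn; rewrite am_shift, neg_cos by exact hk; ring.
Qed.

Lemma is_derive_cn2 k u : -1 < k < 1 -> is_derive (cn2 k) u (cn2' k u).
Proof.
  intros hk; pose proof (is_derive_am k u hk) as h.
  unfold cn2, cn2', jacobi_cn; auto_derive.
  - eexists; exact h.
  - rewrite (is_derive_unique _ _ _ h); ring.
Qed.

Lemma is_derive_cn2' k u : -1 < k < 1 ->
  is_derive (cn2' k) u
    (2 * (1 - k ^ 2) + 4 * (2 * k ^ 2 - 1) * cn2 k u - 6 * k ^ 2 * cn2 k u ^ 2).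
Proof.
  intros hk; pose proof (is_derive_am k u hk) as h.
  pose proof (is_derive_Delta k (jacobi_am u k) hk) as hD.
  pose proof (Delta_pos k (jacobi_am u k) hk) as hpos.
  pose proof (Delta_sqr k (jacobi_am u k) hk) as hsq.
  pose proof (sin2_cos2 (jacobi_am u k)) as hsc; unfold Rsqr in hsc.
  unfold cn2, cn2', jacobi_cn; auto_derive.
  - repeat split; first [eexists; exact h | eexists; exact hD].
  - rewrite (is_derive_unique _ _ _ h).
    change (Derive (fun x => Delta k x) (jacobi_am u k))
      with (Derive (Delta k) (jacobi_am u k)).
    rewrite (is_derive_unique _ _ _ hD).
    set (S := sin (jacobi_am u k)) in *; set (C := cos (jacobi_am u k)) in *.
    set (D := Delta k (jacobi_am u k)) in *.
    replace (C ^ 2) with (1 - S ^ 2) by (simpl; lra).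
    transitivity (2 * (S ^ 2 - C ^ 2) * D ^ 2 + 2 * k ^ 2 * S ^ 2 * C ^ 2).
    + field; lra.
    + rewrite hsq; replace (C ^ 2) with (1 - S ^ 2) by (simpl; lra); ring.
Qed.

(** * Smoothness along the real line *)

(** By induction, every iterated derivative of a member of [S] is again a
    member of [S]. *)
Lemma derivation_closed_smooth (S : (R -> R) -> Prop) :
  (forall f, S f -> exists g, S g /\ forall x, is_derive f x (g x)) ->
  forall f, S f -> forall n x, ex_derive_n f n x.
Proof.
  intros hS f hf.
  assert (h : forall n, exists g, S g /\ forall x, Derive_n f n x = g x).
  { induction n as [|n [g [hg e]]].
    - exists f; split; [exact hf | reflexivity].
    - destruct (hS g hg) as [g' [hg' d]].
      exists g'; split; [exact hg'|]; intros x; simpl.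
      rewrite (Derive_ext _ g x e); apply is_derive_unique, d. }
  intros [|n] x; [exact I|]; simpl.
  destruct (h n) as [g [hg e]]; destruct (hS g hg) as [g' [_ d]].
  apply ex_derive_ext with g; [intros t; symmetry; apply e|].
  eexists; apply d.
Qed.

Inductive poly_in (f g : R -> R) : (R -> R) -> Prop :=
| poly_const c : poly_in f g (fun _ => c)
| poly_fst : poly_in f g f
| poly_snd : poly_in f g g
| poly_plus p q :
    poly_in f g p -> poly_in f g q -> poly_in f g (fun x => p x + q x)
| poly_mult p q :
    poly_in f g p -> poly_in f g q -> poly_in f g (fun x => p x * q x).

(** Differentiation maps the polynomials in [f] and [f'] to themselves as soon
    as [f''] is a polynomial in [f]. *)
Lemma quadratic_ode_smooth (f g : R -> R) (al be ga : R) :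
  (forall x, is_derive f x (g x)) ->
  (forall x, is_derive g x (al + be * f x + ga * (f x * f x))) ->
  forall p, poly_in f g p -> forall n x, ex_derive_n p n x.
Proof.
  intros hf hg; apply derivation_closed_smooth.
  intros p hp; induction hp as [c| | |p q hp [p' [ip dp]] hq [q' [iq dq]]
    |p q hp [p' [ip dp]] hq [q' [iq dq]]].
  - exists (fun _ => 0); split; [apply poly_const|].
    intros x; apply (@is_derive_const R_AbsRing R_NormedModule).
  - exists g; split; [apply poly_snd | exact hf].
  - eexists; split; [|exact hg].
    repeat first [apply poly_plus | apply poly_mult | apply poly_fst
                 | apply poly_const].
  - exists (fun x => p' x + q' x); split; [apply poly_plus; assumption|].
    intros x; apply (@is_derive_plus R_AbsRing R_NormedModule); auto.
  - exists (fun x => p' x * q x + p x * q' x); split.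
    + apply poly_plus; apply poly_mult; assumption.
    + intros x; apply (is_derive_mult p q); auto; exact Rmult_comm.
Qed.

(** * Smoothness in the parameters *)

Lemma derivation_closed_smooth_on D (S : (R * R * R -> R) -> Prop) :
  (forall f, S f -> (forall p, D p -> continuous f p) /\
    exists f1 f2 f3, S f1 /\ S f2 /\ S f3 /\
      forall x y z, D (x, y, z) ->
        is_derive (fun t => f (t, y, z)) x (f1 (x, y, z)) /\
        is_derive (fun t => f (x, t, z)) y (f2 (x, y, z)) /\
        is_derive (fun t => f (x, y, t)) z (f3 (x, y, z))) ->
  forall f, S f -> smooth_on D f.
Proof.
  intros hS f hf n; revert f hf.
  induction n as [|n IH]; intros f hf;
    destruct (hS f hf) as [hc [f1 [f2 [f3 [h1 [h2 [h3 hd]]]]]]];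
    (split; [exact hc|]); [exact I|].
  exists f1, f2, f3; split; [exact hd|].
  split; [|split]; apply IH; assumption.
Qed.

Lemma smooth_on_ext D f g :
  (forall p, f p = g p) -> smooth_on D f -> smooth_on D g.
Proof.
  intros e hf n; specialize (hf n); destruct n as [|n];
    destruct hf as [hc hd]; (split;
    [intros p hp; apply (continuous_ext f); [exact e | apply hc, hp]|]).
  - exact I.
  - destruct hd as [f1 [f2 [f3 [hd h]]]]; exists f1, f2, f3.
    split; [|exact h]; intros x y z hp.
    destruct (hd x y z hp) as [d1 [d2 d3]].
    split; [|split]; eapply is_derive_ext; eauto; intros; apply e.
Qed.

(** [ellipticK] is [J 0 1]; the other exponents are those that its iterated
    derivatives in the modulus produce. *)
Definition J (m n : nat) (k : R) : R :=
  RInt (fun t => sin t ^ m * (/ Delta k t) ^ n) 0 (PI / 2).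

Lemma J_0_1 k : J 0 1 k = ellipticK k.
Proof.
  apply (@RInt_ext R_CompleteNormedModule); intros t _; simpl.
  rewrite Rmult_1_l, Rmult_1_r; reflexivity.
Qed.

Lemma is_derive_J_integrand m n k t : -1 < k < 1 ->
  is_derive (fun k => sin t ^ m * (/ Delta k t) ^ n) k
    (INR n * k * (sin t ^ (m + 2) * (/ Delta k t) ^ (n + 2))).
Proof.
  intros hk; pose proof (Delta_arg_pos k t hk).
  pose proof (Delta_pos k t hk) as hD.
  assert (d : is_derive (fun k => Delta k t) k (- k * sin t ^ 2 / Delta k t)).
  { unfold Delta in *; auto_derive; [lra|].
    replace (1 + - (k * (k * 1) * (sin t * (sin t * 1))))
      with (1 - k ^ 2 * sin t ^ 2) by ring.
    field; lra. }
  evar_last.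
  - apply is_derive_scal, is_derive_pow, is_derive_inv; [exact d | lra].
  - rewrite !pow_add; destruct n as [|n]; [simpl; ring|].
    rewrite Nat.pred_succ; cbn -[INR]; field; lra.
Qed.

Lemma locally_between (a b x : R) : a < x < b ->
  locally x (fun y => a < y < b).
Proof.
  intros [h1 h2].
  apply (locally_interval _ x (Finite a) (Finite b) h1 h2); tauto.
Qed.

Lemma continuity_2d_pt_pow (f : R -> R -> R) n x y :
  continuity_2d_pt f x y -> continuity_2d_pt (fun u v => f u v ^ n) x y.
Proof.
  intros hf; induction n as [|n IH]; simpl.
  - apply continuity_2d_pt_const.
  - apply continuity_2d_pt_mult; assumption.
Qed.

Lemma continuity_2d_pt_sin x y : continuity_2d_pt (fun _ v => sin v) x y.
Proof.
  apply (continuity_1d_2d_pt_comp sin (fun _ v => v));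
    [apply continuity_sin | apply continuity_2d_pt_id2].
Qed.

Lemma continuity_2d_pt_J_integrand m n k t : -1 < k < 1 ->
  continuity_2d_pt (fun k t => sin t ^ m * (/ Delta k t) ^ n) k t.
Proof.
  intros hk; apply continuity_2d_pt_mult; apply continuity_2d_pt_pow.
  - apply continuity_2d_pt_sin.
  - apply continuity_2d_pt_inv.
    + apply (continuity_1d_2d_pt_comp sqrt).
      * apply continuity_pt_sqrt, Rlt_le, Delta_arg_pos, hk.
      * apply continuity_2d_pt_minus; [apply continuity_2d_pt_const|].
        apply continuity_2d_pt_mult; apply continuity_2d_pt_pow;
          [apply continuity_2d_pt_id1 | apply continuity_2d_pt_sin].
    + pose proof (Delta_pos k t hk); lra.
Qed.

(** The integrand and its derivative in [k] are jointly continuous for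
    [-1 < k < 1], which allows differentiation under the integral sign. *)
Lemma is_derive_J m n k : -1 < k < 1 ->
  is_derive (J m n) k (INR n * k * J (m + 2) (n + 2) k).
Proof.
  intros hk.
  assert (hint : forall m n k, -1 < k < 1 ->
    ex_RInt (fun t => sin t ^ m * (/ Delta k t) ^ n) 0 (PI / 2)).
  { intros m' n' k' hk'.
    apply (@ex_RInt_continuous R_CompleteNormedModule); intros t _.
    apply (@continuous_mult R_UniformSpace R_AbsRing);
      apply (@ex_derive_continuous R_AbsRing R_NormedModule).
    - auto_derive; exact I.
    - eexists; apply is_derive_pow, is_derive_inv.
      + apply is_derive_Delta, hk'.
      + pose proof (Delta_pos k' t hk'); lra. }
  assert (e : RInt (fun t => Derive
      (fun k => sin t ^ m * (/ Delta k t) ^ n) k) 0 (PI / 2)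
    = INR n * k * J (m + 2) (n + 2) k).
  { transitivity (RInt (fun t => scal (INR n * k)
      (sin t ^ (m + 2) * (/ Delta k t) ^ (n + 2))) 0 (PI / 2)).
    - apply (@RInt_ext R_CompleteNormedModule); intros t _.
      apply is_derive_unique, is_derive_J_integrand, hk.
    - apply (@RInt_scal R_CompleteNormedModule), hint, hk. }
  rewrite <- e.
  apply (is_derive_RInt_param (fun k t => sin t ^ m * (/ Delta k t) ^ n)).
  - apply (filter_imp (fun y => -1 < y < 1));
      [|apply locally_between, hk].
    intros y hy t _; eexists; apply is_derive_J_integrand, hy.
  - intros t _.
    apply continuity_2d_pt_ext_loc with
      (fun k t => INR n * k * (sin t ^ (m + 2) * (/ Delta k t) ^ (n + 2))).
    + destruct (locally_between _ _ _ hk) as [delta hd].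
      exists delta; intros u v hu _; symmetry.
      apply is_derive_unique, is_derive_J_integrand, hd, hu.
    + apply continuity_2d_pt_mult;
        [|apply continuity_2d_pt_J_integrand, hk].
      apply continuity_2d_pt_mult;
        [apply continuity_2d_pt_const | apply continuity_2d_pt_id1].
  - apply (filter_imp (fun y => -1 < y < 1));
      [|apply locally_between, hk].
    intros y hy; apply hint, hy.
Qed.

Lemma modulus_sqr_lt k : 0 < k < 1 / sqrt 2 -> k ^ 2 < 1 / 2.
Proof.
  intros [h0 h1].
  pose proof (sqrt_lt_R0 2 ltac:(lra)) as hs.
  pose proof (sqrt_def 2 ltac:(lra)) as h2.
  assert (hr : (1 / sqrt 2) * (1 / sqrt 2) = 1 / 2)
    by (transitivity (1 / (sqrt 2 * sqrt 2)); [field; lra | rewrite h2; ring]).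
  nra.
Qed.

Lemma modulus_bound k : 0 < k < 1 / sqrt 2 -> -1 < k < 1.
Proof. intros h; pose proof (modulus_sqr_lt k h); nra. Qed.

(** The functions of [(b, omega, k)] to which [derivation_closed_smooth_on] is
    applied.  The generators are those of the coefficient formulas, enlarged
    by all [J m n] so that partial derivatives stay inside; reciprocals are
    restricted to functions without zeros on the parameter domain. *)
Inductive elementary : (R * R * R -> R) -> Prop :=
| el_const c : elementary (fun _ => c)
| el_b : elementary (fun p => fst (fst p))
| el_omega : elementary (fun p => snd (fst p))
| el_k : elementary (fun p => snd p)
| el_sqrt : elementary (fun p => sqrt (snd (fst p) ^ 2 + 8))
| el_J m n : elementary (fun p => J m n (snd p))
| el_plus f g :
    elementary f -> elementary g -> elementary (fun p => f p + g p)
| el_mult f g :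
    elementary f -> elementary g -> elementary (fun p => f p * g p)
| el_inv f : elementary f -> (forall p, param_domain p -> f p <> 0) ->
    elementary (fun p => / f p).

Lemma elementary_continuous f :
  elementary f -> forall p, param_domain p -> continuous f p.
Proof.
  intros hf [[b w] k] hp; induction hf as [c| | | | |m n|f g _ IHf _ IHg
    |f g _ IHf _ IHg|f _ IH hn].
  - apply continuous_const.
  - apply (continuous_comp fst fst); apply continuous_fst.
  - apply (continuous_comp fst snd); [apply continuous_fst|apply continuous_snd].
  - apply continuous_snd.
  - apply (continuous_comp (fun p : R * R * R => snd (fst p))
      (fun w => sqrt (w ^ 2 + 8))).
    + apply (continuous_comp fst snd);
        [apply continuous_fst|apply continuous_snd].
    + apply (@ex_derive_continuous R_AbsRing R_NormedModule).
      auto_derive; simpl; nra.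
  - apply (continuous_comp snd (J m n)); [apply continuous_snd|].
    apply (@ex_derive_continuous R_AbsRing R_NormedModule).
    eexists; apply is_derive_J, modulus_bound, hp.
  - apply (@continuous_plus _ R_AbsRing R_NormedModule); assumption.
  - apply (@continuous_mult _ R_AbsRing); assumption.
  - apply (continuous_comp f Rinv); [assumption|].
    apply continuous_Rinv, hn, hp.
Qed.

Lemma elementary_derivatives f : elementary f ->
  exists f1 f2 f3, elementary f1 /\ elementary f2 /\ elementary f3 /\
    forall x y z, param_domain (x, y, z) ->
      is_derive (fun t => f (t, y, z)) x (f1 (x, y, z)) /\
      is_derive (fun t => f (x, t, z)) y (f2 (x, y, z)) /\
      is_derive (fun t => f (x, y, t)) z (f3 (x, y, z)).
Proof.
  assert (hc : forall x c : R, is_derive (fun _ : R => c) x 0)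
    by (intros; apply (@is_derive_const R_AbsRing R_NormedModule)).
  assert (hid : forall x : R, is_derive (fun t : R => t) x 1)
    by (intros; apply (@is_derive_id R_AbsRing)).
  intros hf; induction hf as [c| | | | |m n
    |f g hf [f1 [f2 [f3 [hf1 [hf2 [hf3 df]]]]]]
         hg [g1 [g2 [g3 [hg1 [hg2 [hg3 dg]]]]]]
    |f g hf [f1 [f2 [f3 [hf1 [hf2 [hf3 df]]]]]]
         hg [g1 [g2 [g3 [hg1 [hg2 [hg3 dg]]]]]]
    |f hf [f1 [f2 [f3 [hf1 [hf2 [hf3 df]]]]]] hn].
  - exists (fun _ => 0), (fun _ => 0), (fun _ => 0).
    do 3 (split; [apply el_const|]); simpl; auto.
  - exists (fun _ => 1), (fun _ => 0), (fun _ => 0).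
    do 3 (split; [apply el_const|]); simpl; auto.
  - exists (fun _ => 0), (fun _ => 1), (fun _ => 0).
    do 3 (split; [apply el_const|]); simpl; auto.
  - exists (fun _ => 0), (fun _ => 0), (fun _ => 1).
    do 3 (split; [apply el_const|]); simpl; auto.
  - exists (fun _ => 0),
      (fun p => snd (fst p) * / sqrt (snd (fst p) ^ 2 + 8)), (fun _ => 0).
    split; [apply el_const | split; [|split; [apply el_const|]]].
    + apply el_mult; [apply el_omega | apply el_inv; [apply el_sqrt|]].
      intros p _; apply Rgt_not_eq, sqrt_lt_R0; nra.
    + intros x y z _; cbn -[pow]; split; [|split]; auto.
      pose proof (sqrt_lt_R0 (y ^ 2 + 8) ltac:(nra)).
      auto_derive; [simpl; nra|].
      replace (y * (y * 1) + 8) with (y ^ 2 + 8) by ring.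
      field; lra.
  - exists (fun _ => 0), (fun _ => 0),
      (fun p => INR n * snd p * J (m + 2) (n + 2) (snd p)).
    split; [apply el_const | split; [apply el_const | split]].
    + apply el_mult; [apply el_mult; [apply el_const | apply el_k] | apply el_J].
    + intros x y z hp; cbn -[J INR]; split; [|split]; auto.
      apply is_derive_J, modulus_bound, hp.
  - exists (fun p => f1 p + g1 p), (fun p => f2 p + g2 p),
      (fun p => f3 p + g3 p).
    do 3 (split; [apply el_plus; assumption|]); intros x y z hp.
    destruct (df x y z hp) as [d1 [d2 d3]];
      destruct (dg x y z hp) as [e1 [e2 e3]].
    split; [|split]; apply (@is_derive_plus R_AbsRing R_NormedModule); assumption.
  - exists (fun p => f1 p * g p + f p * g1 p),
      (fun p => f2 p * g p + f p * g2 p), (fun p => f3 p * g p + f p * g3 p).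
    do 3 (split; [apply el_plus; apply el_mult; assumption|]); intros x y z hp.
    destruct (df x y z hp) as [d1 [d2 d3]];
      destruct (dg x y z hp) as [e1 [e2 e3]].
    split; [|split].
    + apply (is_derive_mult (fun t => f (t, y, z)) (fun t => g (t, y, z)));
        auto; exact Rmult_comm.
    + apply (is_derive_mult (fun t => f (x, t, z)) (fun t => g (x, t, z)));
        auto; exact Rmult_comm.
    + apply (is_derive_mult (fun t => f (x, y, t)) (fun t => g (x, y, t)));
        auto; exact Rmult_comm.
  - exists (fun p => -1 * f1 p * (/ f p * / f p)),
      (fun p => -1 * f2 p * (/ f p * / f p)),
      (fun p => -1 * f3 p * (/ f p * / f p)).
    do 3 (split; [repeat apply el_mult; try apply el_const; try assumption;
      apply el_inv; assumption|]).
    intros x y z hp; destruct (df x y z hp) as [d1 [d2 d3]].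
    pose proof (hn _ hp) as h0.
    assert (e : forall l, -1 * l * (/ f (x, y, z) * / f (x, y, z))
      = - l / f (x, y, z) ^ 2) by (intros l; field; exact h0).
    rewrite !e; split; [|split].
    + apply (is_derive_inv (fun t => f (t, y, z))); assumption.
    + apply (is_derive_inv (fun t => f (x, t, z))); assumption.
    + apply (is_derive_inv (fun t => f (x, y, t))); assumption.
Qed.

Lemma elementary_smooth f : elementary f -> smooth_on param_domain f.
Proof.
  apply derivation_closed_smooth_on; intros g hg.
  split; [apply elementary_continuous | apply elementary_derivatives];
    exact hg.
Qed.

(** * The two roots of the proportionality condition *)

Lemma sqrt_disc omega : 0 <= sqrt (omega ^ 2 + 8) /\
  sqrt (omega ^ 2 + 8) * sqrt (omega ^ 2 + 8) = omega ^ 2 + 8.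
Proof. split; [apply sqrt_pos | apply sqrt_def; nra]. Qed.

Lemma B_plus_gt_1 omega : -1 < omega < 1 -> 1 < B_plus omega.
Proof.
  intros h; destruct (sqrt_disc omega); unfold B_plus; nra.
Qed.

Lemma B_minus_lt_m1 omega : -1 < omega < 1 -> B_minus omega < -1.
Proof.
  intros h; destruct (sqrt_disc omega); unfold B_minus; nra.
Qed.

Lemma B_quadratic B omega : B = B_plus \/ B = B_minus ->
  B omega ^ 2 = 2 - omega * B omega.
Proof.
  intros hB; destruct (sqrt_disc omega) as [_ h].
  destruct hB as [-> | ->]; unfold B_plus, B_minus; nra.
Qed.

Lemma B_sqr_gt_1 B omega : B = B_plus \/ B = B_minus -> -1 < omega < 1 ->
  1 < B omega ^ 2.
Proof.
  intros hB h; pose proof (B_plus_gt_1 omega h);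
    pose proof (B_minus_lt_m1 omega h).
  destruct hB as [-> | ->]; nra.
Qed.

Lemma elementary_B B : B = B_plus \/ B = B_minus ->
  exists f, elementary f /\ forall p, f p = B (snd (fst p)).
Proof.
  intros [-> | ->]; [exists (fun p => - (1 / 2) * snd (fst p)
      + 1 / 2 * sqrt (snd (fst p) ^ 2 + 8))
    | exists (fun p => - (1 / 2) * snd (fst p)
      + - (1 / 2) * sqrt (snd (fst p) ^ 2 + 8))];
    (split; [apply el_plus; apply el_mult;
      first [apply el_const | apply el_omega | apply el_sqrt]
    | intros p; unfold B_plus, B_minus; field]).
Qed.

(** * The cnoidal coefficients *)

Lemma coef_b0_eq L B b omega k : L <> 0 -> B <> 0 -> B * omega - 1 <> 0 ->
  B ^ 2 = 2 - omega * B ->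
  coef_b0 L B b omega k * B ^ 2 =
  (B * omega - 1) * (1 - 4 * b * (2 * k ^ 2 - 1) * (2 * ellipticK k / L) ^ 2).
Proof.
  intros hL hB hw hq; unfold coef_b0.
  (* Modulo [B^2 + omega B = 2], the part of the numerator of [coef_b0] that
     does not involve [K] is a square times [2 L^2]. *)
  assert (e : ((omega ^ 2 + 1 / 2) * B - 3 / 2 * omega) * B
    = (B * omega - 1) ^ 2) by nra.
  replace (2 * ((omega ^ 2 + 1 / 2) * B - 3 / 2 * omega) * B * L ^ 2)
    with (2 * (((omega ^ 2 + 1 / 2) * B - 3 / 2 * omega) * B) * L ^ 2) by ring.
  rewrite e; field; auto.
Qed.

Lemma coef_b2_eq L B b omega k : L <> 0 -> B <> 0 ->
  coef_b2 L B b omega k * B ^ 2 =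
  12 * b * k ^ 2 * (B * omega - 1) * (2 * ellipticK k / L) ^ 2.
Proof. intros hL hB; unfold coef_b2; field; auto. Qed.

Lemma smooth_coefficients L B : 0 < L -> B = B_plus \/ B = B_minus ->
  smooth_on param_domain (fun '(b, omega, k) => B omega) /\
  smooth_on param_domain
    (fun '(b, omega, k) => coef_b0 L (B omega) b omega k) /\
  smooth_on param_domain
    (fun '(b, omega, k) => coef_b2 L (B omega) b omega k).
Proof.
  intros hL hB; destruct (elementary_B B hB) as [f [hf ef]].
  assert (hdom : forall p, param_domain p -> f p <> 0 /\
    f p * snd (fst p) - 1 < 0).
  { intros [[b w] k] [_ [hw _]]; rewrite ef; cbn [fst snd].
    pose proof (B_sqr_gt_1 B w hB hw); pose proof (B_quadratic B w hB).
    split; [intros e; rewrite e in *|]; lra. }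
  split; [|split].
  - apply (smooth_on_ext _ f); [|apply elementary_smooth, hf].
    intros [[b w] k]; apply ef.
  - apply (smooth_on_ext _ (fun p =>
      (-64 * ((f p * snd (fst p) + -1) * (f p * snd (fst p) + -1))
         * fst (fst p) * (snd p * snd p + - (1 / 2))
         * (J 0 1 (snd p) * J 0 1 (snd p))
       + 2 * ((snd (fst p) * snd (fst p) + 1 / 2) * f p
              + - (3 / 2) * snd (fst p)) * f p * L ^ 2)
      * / (2 * (f p * f p) * L ^ 2 * (f p * snd (fst p) + -1)))).
    + intros [[b w] k]; rewrite ef, J_0_1; unfold coef_b0.
      apply (f_equal2 Rdiv); cbn [fst snd]; field.
    + apply elementary_smooth, el_mult; [|apply el_inv].
      * auto 20 using elementary.
      * auto 20 using elementary.
      * intros p hp; destruct (hdom p hp).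
        repeat apply Rmult_integral_contrapositive_currified; lra.
  - apply (smooth_on_ext _ (fun p =>
      48 * fst (fst p) * (snd p * snd p) * (f p * snd (fst p) + -1)
        * (J 0 1 (snd p) * J 0 1 (snd p)) * / (f p * f p * L ^ 2))).
    + intros [[b w] k]; rewrite ef, J_0_1; unfold coef_b2.
      apply (f_equal2 Rdiv); cbn [fst snd]; field.
    + apply elementary_smooth, el_mult; [|apply el_inv].
      * auto 20 using elementary.
      * auto 20 using elementary.
      * intros p hp; destruct (hdom p hp).
        repeat apply Rmult_integral_contrapositive_currified; lra.
Qed.

(** * The cnoidal wave *)

(** The scalar equation to which both equations of the system reduce: [e2] and
    [e0] are the vanishing of the coefficients of [p^2] and [p], where [p]
    stands for [cn^2]. *)
Lemma cnoidal_balance B b omega k s b0 b2 p :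
  b0 * B ^ 2 = (B * omega - 1) * (1 - 4 * b * (2 * k ^ 2 - 1) * s ^ 2) ->
  b2 * B ^ 2 = 12 * b * k ^ 2 * (B * omega - 1) * s ^ 2 ->
  (1 - B * omega) * (b0 + b2 * p - b * (b2 * s ^ 2 *
      (2 * (1 - k ^ 2) + 4 * (2 * k ^ 2 - 1) * p - 6 * k ^ 2 * p ^ 2)))
    + B ^ 2 / 2 * (b0 + b2 * p) ^ 2 =
  (1 - B * omega) * (b0 - 2 * b * b2 * s ^ 2 * (1 - k ^ 2))
    + B ^ 2 / 2 * b0 ^ 2.
Proof.
  intros e0 e2.
  assert (h2 : b2 / 2 * p ^ 2 * (b2 * B ^ 2) = b2 / 2 * p ^ 2 *
    (12 * b * k ^ 2 * (B * omega - 1) * s ^ 2)) by (rewrite e2; reflexivity).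
  assert (h0 : b2 * p * (b0 * B ^ 2) = b2 * p *
    ((B * omega - 1) * (1 - 4 * b * (2 * k ^ 2 - 1) * s ^ 2)))
    by (rewrite e0; reflexivity).
  lra.
Qed.

Lemma Derive_n_2_of (f f' : R -> R) x l :
  (forall y, is_derive f y (f' y)) -> is_derive f' x l ->
  Derive_n f 2 x = l.
Proof.
  intros h h'; simpl; rewrite (Derive_ext _ f').
  - apply is_derive_unique, h'.
  - intros t; apply is_derive_unique, h.
Qed.

Lemma Derive_n_2_affine (f f' : R -> R) al be x l :
  (forall y, is_derive f y (f' y)) -> is_derive f' x l ->
  Derive_n (fun y => al + be * f y) 2 x = be * l.
Proof.
  intros h h'; apply Derive_n_2_of with (fun y => be * f' y).
  - intros y; rewrite <- (Rplus_0_l (be * f' y)).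
    apply (@is_derive_plus R_AbsRing R_NormedModule (fun _ => al)).
    + apply (@is_derive_const R_AbsRing R_NormedModule).
    + apply (is_derive_scal f), h.
  - apply (is_derive_scal f'), h'.
Qed.

Theorem proposition3p1 (L : R) (hL : 0 < L) :
  (forall omega : R, -1 < omega < 1 -> 0 < B_plus omega /\ B_minus omega < 0) /\
  (forall B : R -> R, B = B_plus \/ B = B_minus ->
     smooth_on param_domain (fun '(b, omega, k) => B omega) /\
     smooth_on param_domain (fun '(b, omega, k) => coef_b0 L (B omega) b omega k) /\
     smooth_on param_domain (fun '(b, omega, k) => coef_b2 L (B omega) b omega k) /\
     forall a b c d omega k : R,
       param_domain (b, omega, k) ->
       a = c -> c < 0 -> b = d -> 0 < d -> a + b = 0 ->
       exists (A1 A2 : R) (phi psi : R -> R),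
         smooth_periodic L phi /\
         smooth_periodic L psi /\
         (forall x, - omega * phi x + psi x + phi x * psi x
                    + a * Derive_n psi 2 x + b * omega * Derive_n phi 2 x - A1 = 0) /\
         (forall x, - omega * psi x + phi x + 1 / 2 * psi x ^ 2
                    + c * Derive_n phi 2 x + d * omega * Derive_n psi 2 x - A2 = 0) /\
         (forall x, psi x = B omega * phi x) /\
         (forall x, phi x = coef_b0 L (B omega) b omega k
                    + coef_b2 L (B omega) b omega k
                      * jacobi_cn (2 * ellipticK k / L * x) k ^ 2) /\
         (forall x, phi x < 0)).
Proof.
  split.
  { intros omega h; pose proof (B_plus_gt_1 omega h);
      pose proof (B_minus_lt_m1 omega h); lra. }
  intros B hB; destruct (smooth_coefficients L B hL hB) as [s1 [s2 s3]].
  do 3 (split; [assumption|]).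
  intros a b c d omega k [_ [hw hk]] hac hc0 hbd hd hab.
  assert (a = - b) as -> by lra; subst c d; clear hab hc0.
  pose proof (modulus_bound k hk) as hk1; pose proof (modulus_sqr_lt k hk).
  pose proof (B_sqr_gt_1 B omega hB hw) as hB1.
  pose proof (B_quadratic B omega hB) as hBq.
  assert (hBw : B omega * omega - 1 < 0) by lra.
  assert (hB0 : B omega <> 0) by (intros e; rewrite e in hB1; lra).
  pose proof (coef_b0_eq L (B omega) b omega k ltac:(lra) hB0 ltac:(lra) hBq)
    as e0.
  pose proof (coef_b2_eq L (B omega) b omega k ltac:(lra) hB0) as e2.
  set (b0 := coef_b0 L (B omega) b omega k) in *.
  set (b2 := coef_b2 L (B omega) b omega k) in *.
  set (s := 2 * ellipticK k / L) in *; set (beta := B omega) in *.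
  set (q := fun x => cn2 k (s * x)); set (q' := fun x => s * cn2' k (s * x)).
  assert (hscale : forall x, is_derive (fun x => s * x) x s)
    by (intros x; auto_derive; [exact I | ring]).
  assert (dq : forall x, is_derive q x (q' x)).
  { intros x; apply (is_derive_comp (cn2 k) (fun x => s * x));
      [apply is_derive_cn2, hk1 | apply hscale]. }
  assert (dq' : forall x, is_derive q' x (s ^ 2 *
    (2 * (1 - k ^ 2) + 4 * (2 * k ^ 2 - 1) * q x - 6 * k ^ 2 * q x ^ 2))).
  { intros x; unfold q'.
    replace (s ^ 2 * _) with (s * (s * (2 * (1 - k ^ 2)
      + 4 * (2 * k ^ 2 - 1) * q x - 6 * k ^ 2 * q x ^ 2))) by ring.
    apply (is_derive_scal (fun x => cn2' k (s * x))).
    apply (is_derive_comp (cn2' k) (fun x => s * x));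
      [apply is_derive_cn2', hk1 | apply hscale]. }
  assert (hsmooth : forall p, poly_in q q' p -> forall n x, ex_derive_n p n x).
  { apply (quadratic_ode_smooth q q' (s ^ 2 * (2 * (1 - k ^ 2)))
      (s ^ 2 * (4 * (2 * k ^ 2 - 1))) (s ^ 2 * (-6 * k ^ 2)) dq).
    intros x; evar_last; [apply dq' | ring]. }
  assert (hper : forall x, q (x + L) = q x).
  { intros x; unfold q; rewrite <- (cn2_periodic k (s * x) hk1).
    f_equal; unfold s; field; lra. }
  set (A2 := (1 - beta * omega) * (b0 - 2 * b * b2 * s ^ 2 * (1 - k ^ 2))
    + beta ^ 2 / 2 * b0 ^ 2).
  assert (hphi2 : forall x, Derive_n (fun x => b0 + b2 * q x) 2 x = b2 * (s ^ 2
    * (2 * (1 - k ^ 2) + 4 * (2 * k ^ 2 - 1) * q x - 6 * k ^ 2 * q x ^ 2)))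
    by (intros x; apply Derive_n_2_affine with q'; auto).
  assert (hpsi2 : forall x, Derive_n (fun x => beta * (b0 + b2 * q x)) 2 x
    = beta * Derive_n (fun x => b0 + b2 * q x) 2 x)
    by (intros x; apply Derive_n_scal_l).
  assert (hbal : forall x, (1 - beta * omega) * (b0 + b2 * q x
      - b * Derive_n (fun x => b0 + b2 * q x) 2 x)
    + beta ^ 2 / 2 * (b0 + b2 * q x) ^ 2 = A2).
  { intros x; rewrite hphi2; unfold A2.
    rewrite <- (cnoidal_balance beta b omega k s b0 b2 (q x) e0 e2); ring. }
  exists (2 / beta * A2), A2,
    (fun x => b0 + b2 * q x), (fun x => beta * (b0 + b2 * q x)).
  repeat split.
  - apply hsmooth; repeat constructor.
  - intros x; rewrite hper; reflexivity.
  - apply hsmooth; repeat constructor.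
  - intros x; rewrite hper; reflexivity.
  - intros x; rewrite hpsi2, <- (hbal x).
    generalize (Derive_n (fun x => b0 + b2 * q x) 2 x); intros phi2.
    (* Multiplied by [beta / 2], the first equation becomes the second. *)
    assert (e : beta - omega = 2 / beta * (1 - beta * omega)).
    { apply (Rmult_eq_reg_l beta); [|exact hB0].
      transitivity (2 * (1 - beta * omega)); [lra | field; exact hB0]. }
    transitivity ((beta - omega) * (b0 + b2 * q x - b * phi2)
      - 2 / beta * (1 - beta * omega) * (b0 + b2 * q x - b * phi2));
      [field; exact hB0 | rewrite e; ring].
  - intros x; rewrite hpsi2, <- (hbal x); field.
  - intros x.
    assert (hs : 0 <= s ^ 2) by apply pow2_ge_0.
    assert (h0 : b0 < 0).
    { assert (0 <= b * (1 - 2 * k ^ 2) * s ^ 2)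
        by (apply Rmult_le_pos; [apply Rmult_le_pos; lra | exact hs]).
      assert (b0 * beta ^ 2 < 0) by (rewrite e0; nra).
      nra. }
    assert (h2 : b2 <= 0).
    { assert (0 <= b * k ^ 2 * s ^ 2)
        by (apply Rmult_le_pos; [apply Rmult_le_pos; nra | exact hs]).
      assert (b2 * beta ^ 2 <= 0) by (rewrite e2; nra).
      nra. }
    assert (0 <= q x) by apply pow2_ge_0.
    nra.
Qed.
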